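(* For each positive integer $n$, let $X_n=\{X_n(t);\,t\geqslant 0\}$ be a stochastic process converging in distribution to $\nu_n$ as $t\to\infty$, and let $d_n(t)$ be the distance between the distribution of $X_n(t)$ and $\nu_n$, where the maximum of the distance is $M=+\infty$. Assume that for each $n$ there exist an increasing sequence of positive reals $(\rho_{i,n})_{i\geqslant 1}$ and a sequence of non-negative reals $(a_{i,n})_{i\geqslant 1}$ with $a_{1,n}>0$, such that $$d_n(t)=\sum_{i=1}^{+\infty} a_{i,n}\,\mathrm{e}^{-\rho_{i,n}t}.$$ Put $$A_{i,n}=\max\{1,\,a_{1,n}+\cdots+a_{i,n}\},$$ and for each $n$ define $$t_n=\sup_{i}\frac{\log(A_{i,n})}{\rho_{i,n}},\qquad w_n=\frac{1}{\rho_{1,n}},\qquad r_n=w_n\bigl(\log(\rho_{1,n}t_n)-\log(\log(\rho_{1,n}t_n))\bigr)$$ (under the assumptions below, $r_n$ is well defined for $n$ large enough). Assume that: 1. for $n$ large enough, $0<t_n<+\infty$; 2. $\lim_{n\to\infty}\rho_{1,n}t_n=+\infty$; 3. there exists a positive real $\alpha$ such that for $n$ large enough and for all $i\geqslant 2$, $a_{i,n}\leqslant \alpha A_{i-1,n}$. Then $(X_n)$ has a left-window cutoff at $(t_n,w_n)$ and a right-window cutoff at $(t_n+r_n,w_n)$. More precisely: $$\forall c<0,\quad \liminf_{n\to\infty} d_n(t_n+c w_n)\geqslant \mathrm{e}^{-c},$$ $$\forall c>0,\quad \limsup_{n\to\infty} d_n(t_n+r_n+c w_n)\leqslant \mathr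m{e}^{-c}.$$
   Context: The distance between probability distributions is one of the usual ones whose maximum is $M=+\infty$ (relative entropy, chi-squared, $L^p$ for $p>1$, etc.); $d_n(t)$ takes values in $[0,+\infty]$. Let $(t_n)$ (location) and $(w_n)$ (width) be two sequences of positive reals such that $w_n=o(t_n)$. The sequence $(X_n)$ has a left-window cutoff at $(t_n,w_n)$ if $$\lim_{c\to-\infty}\liminf_{n\to\infty}\inf_{t<t_n+cw_n} d_n(t)=M,$$ and a right-window cutoff at $(t_n,w_n)$ if $$\lim_{c\to+\infty}\limsup_{n\to\infty}\sup_{t>t_n+cw_n} d_n(t)=0,$$ where $t$ ranges over nonnegative times. Here $M=+\infty$. The right-window cutoff at $(t_n+r_n,w_n)$ means the definition with location $t_n+r_n$ in place of $t_n$. Locations and widths need only be defined, finite and positive for $n$ large enough. *)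

(* Defs.v *)
From HB Require Import structures.
From mathcomp Require Export all_boot all_order all_algebra.
From mathcomp Require Export all_classical all_reals all_analysis.
Export Order.TTheory GRing.Theory Num.Theory.
Export numFieldNormedType.Exports.

#[export] Set Implicit Arguments.
#[export] Unset Strict Implicit.
#[export] Unset Printing Implicit Defensive.

Local Open Scope classical_set_scope.
Local Open Scope ring_scope.

Notation borel T := (g_sigma_algebraType (@open T)).

(* Times range over R; the values of [law] at negative times are irrelevant. *)
Definition cvg_in_distribution (R : realType) (T : ptopologicalType)
    (law : R -> probability (borel T) R) (nu : probability (borel T) R) : Prop :=
  forall f : T -> R, continuous f -> bounded_fun f ->
    (\int[law t]_x (f x)%:E)%E @[t --> +oo] --> (\int[nu]_x (f x)%:E)%E.

(* A "distance" in the sense of relative entropy, chi-squared, L^p, etc.: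
   neither symmetry nor the triangle inequality is required.  Probabilities are
   compared on measurable sets only, because library measures are functions
   on all sets. *)
Record prob_distance (R : realType) (d : measure_display) (T : measurableType d)
    (M : \bar R) (D : probability T R -> probability T R -> \bar R) : Prop := {
  prob_distance_ge0 : forall P Q, (0 <= D P Q)%E ;
  prob_distance_eq0 : forall P Q,
    D P Q = 0%E <-> (forall A, measurable A -> P A = Q A) ;
  prob_distance_sup : ereal_sup [set D P Q | P in setT & Q in setT] = M }.

Section Cutoff.
Variable R : realType.
Implicit Types (t w : nat -> R) (d : nat -> R -> \bar R) (M : \bar R).

(* Locations and widths are only constrained for n large enough. *)
Definition location_width t w : Prop :=
  [/\ \forall n \near \oo, 0 < t n,
      \forall n \near \oo, 0 < w n
    & w n / t n @[n --> \oo] --> 0].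

Definition left_window_cutoff M d t w : Prop :=
  location_width t w /\
  limn_einf (fun n => ereal_inf [set d n s | s in [set s | (0 <= s < t n + c * w n)%R]])
    @[c --> -oo] --> M.

Definition right_window_cutoff d t w : Prop :=
  location_width t w /\
  limn_esup (fun n => ereal_sup [set d n s | s in [set s | (0 <= s)%R /\ (t n + c * w n < s)%R]])
    @[c --> +oo] --> 0%E.

End Cutoff.

Section Exponential_sums.
Variable R : realType.
Implicit Types (a rho : nat -> R).

(* Sequences are indexed by i >= 1; the value at index 0 is never used. *)
Definition cumul a (i : nat) : R := Num.max 1 (\sum_(1 <= j < i.+1) a j).

Definition location_ereal a rho : \bar R :=
  ereal_sup [set (ln (cumul a i) / rho i)%:E | i in [set i | (1 <= i)%N]].

(* Meaningful only when [location_ereal a rho] is finite. *)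
Definition location a rho : R := fine (location_ereal a rho).

Definition width rho : R := (rho 1%N)^-1.

Definition shift a rho : R :=
  let u := rho 1%N * location a rho in width rho * (ln u - ln (ln u)).

End Exponential_sums.

(* Main.v *)
Require Import Defs.
From mathcomp Require Import ring lra.

(** Write [S i] for the partial sums of the coefficients, [A i] for
    [cumul a i], [t] for the location and [u = rho 1 * t].

    Left side. The exponents increase, so at any time [s >= 0] the first [i]
    terms contribute at least [S i * exp(- rho i * s)]. Take an [i] at which
    [ln (A i) / rho i] nearly attains the supremum [t]; there [A i > 1], hence
    [A i = S i], and for [s <= t - b / rho 1] the contribution is nearly
    [exp(rho i * (t - s)) >= exp b]. This gives [d s >= exp b] without any
    limit: [expsum_ge].

    Right side. By definition of [t], [rho i >= max (rho 1) (ln (S i) / t)].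
    Hence the series at time [s = t + delta] is a lower Riemann sum, for the
    subdivision formed by the [S i], of the nonincreasing function
      [x |-> exp(- s * max (rho 1) (ln x / t))]   on (0, +oo).
    It is constant up to [x = exp(rho 1 * t)] and equal to the power
    [x ^ -(1 + delta / t)] afterwards, so its integral is exactly
    [exp(- rho 1 * delta) * (1 + t / delta)]: [expsum_le]. The constant piece,
    which is where [rho i >= rho 1] enters, must be kept apart: the power is
    not integrable at 0.

    Finally put [v = ln u] and [delta = r + c * w]. Then
    [rho 1 * delta = v - ln v + c], and the bound becomes a function of [v]
    alone, equal to [exp(-c) * (v * exp(-v) + v / (v - ln v + c))], which tends
    to [exp(-c)] as [v] tends to infinity ([cvg_right_profile]). So [r] is the
    shift that makes the factor [exp(- rho 1 * r) = v / u] compensate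
    [t / delta], which is of order [u / v]. *)

Local Open Scope classical_set_scope.
Local Open Scope ring_scope.

(** * Bounds on a single exponential sum *)

Section ExponentialSum.
Context {R : realType}.
Implicit Types (a rho : nat -> R) (x y p t r b s delta : R).

(** This is the comparison of [y ^ -(1 + p)], the minimum of the power over
    [[x, y]], with the integral of the power over [[x, y]]. After division by
    [y ^ -p] it follows from the two tangent inequalities
    [ln z <= z - 1] and [1 + z <= exp z]. *)
Lemma expR_ln_increment p x y : 0 < p -> 0 < x -> x <= y ->
  (y - x) * expR (- ((1 + p) * ln y))
    <= p^-1 * (expR (- (p * ln x)) - expR (- (p * ln y))).
Proof.
move=> p0 x0 xy; have y0 : 0 < y := lt_le_trans x0 xy.
have lnxy : ln x - ln y <= x / y - 1.
  rewrite -ln_div// -[x / y in leLHS](subrK 1) addrC.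
  by apply: le_ln1Dx; rewrite ltrBrDl subrr divr_gt0.
have -> : expR (- (p * ln x)) = expR (- (p * ln y)) * expR (p * (ln y - ln x)).
  by rewrite -expRD; congr expR; ring.
have -> : expR (- ((1 + p) * ln y)) = expR (- (p * ln y)) * y^-1.
  by rewrite -[y in y^-1](lnK y0) -expRN -expRD; congr expR; ring.
rewrite -[X in _ * (_ - X)]mulr1 -mulrBr mulrCA [leRHS]mulrCA.
rewrite ler_pM2l ?expR_gt0// ler_pdivlMl//.
have ge := expR_ge1Dx (p * (ln y - ln x)).
have : p * (1 - x / y) <= p * (ln y - ln x) by rewrite ler_pM2l//; lra.
have -> : (y - x) / y = 1 - x / y by field; rewrite gt_eqF.
lra.
Qed.

(** A primitive on (0, +oo) of the function
    [x |-> exp(- (t + delta) * max rho1 (ln x / t))]: linear up to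
    [exp(rho1 * t)], then a multiple of [- x ^ -(delta / t)]. *)
Definition potential (rho1 t delta x : R) : R :=
  Num.min x (expR (rho1 * t)) * expR (- (rho1 * (t + delta)))
  - t / delta * expR (- (delta / t * ln (Num.max x (expR (rho1 * t))))).

(** The integrand is nonincreasing, so its integral over [[x, y]] is at least
    [y - x] times its value at [y], and that value bounds [exp(- r * (t + delta))]
    as [r >= max rho1 (ln y / t)]. The interval is cut at [exp(rho1 * t)], where
    the formula of the integrand changes. *)
Lemma potential_increment (rho1 : R) t delta r x y :
  0 < t -> 0 < delta -> rho1 <= r -> 0 <= x <= y -> ln y <= r * t ->
  (y - x) * expR (- (r * (t + delta)))
    <= potential rho1 t delta y - potential rho1 t delta x.
Proof.
move=> t0 d0 rho1r /andP[x0 xy] lny; rewrite /potential.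
set B := expR (rho1 * t); have B0 : 0 < B by rewrite expR_gt0.
have split_xy : y - x
    = (Num.min y B - Num.min x B) + (Num.max y B - Num.max x B).
  by have := addr_max_min y B; have := addr_max_min x B; lra.
rewrite split_xy mulrDl.
have low : (Num.min y B - Num.min x B) * expR (- (r * (t + delta)))
    <= (Num.min y B - Num.min x B) * expR (- (rho1 * (t + delta))).
  apply: ler_wpM2l; first by rewrite subr_ge0 le_min2.
  by rewrite ler_expR lerN2 ler_wpM2r// ltW// addr_gt0.
have high : (Num.max y B - Num.max x B) * expR (- (r * (t + delta)))
    <= t / delta * (expR (- (delta / t * ln (Num.max x B)))
                    - expR (- (delta / t * ln (Num.max y B)))).
  have [yB|By] := leP y B.
    by rewrite !max_r ?(le_trans xy)// !subrr mul0r mulr0.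
  have xBy : Num.max x B <= y by rewrite ge_max xy ltW.
  have p0 : 0 < delta / t by rewrite divr_gt0.
  have xB0 : 0 < Num.max x B by rewrite lt_max B0 orbT.
  rewrite -[t / delta]invf_div.
  apply: le_trans (expR_ln_increment p0 xB0 xBy).
  apply: ler_wpM2l; first by rewrite subr_ge0.
  rewrite ler_expR lerN2.
  have -> : r * (t + delta) = (1 + delta / t) * (r * t).
    by field; rewrite gt_eqF.
  by rewrite ler_pM2l// addr_gt0.
move: low high; rewrite !mulrBl mulrBr; lra.
Qed.

Lemma ln_cumul_le a rho t i :
  location_ereal a rho = t%:E -> (1 <= i)%N -> 0 < rho i ->
  ln (cumul a i) <= rho i * t.
Proof.
move=> locE i1 rho0; rewrite mulrC -ler_pdivrMr// -lee_fin -locE.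
by apply: ereal_sup_ubound; exists i.
Qed.

(** Each term is at most the increment of [potential] between two consecutive
    partial sums; these increments telescope, and the total variation of
    [potential] on [0, +oo) is the right-hand side. *)
Lemma expsum_le a rho t delta s :
  (forall i, (1 <= i)%N -> 0 <= a i) ->
  0 < rho 1%N -> (forall i, (1 <= i)%N -> rho 1%N <= rho i) ->
  location_ereal a rho = t%:E -> 0 < t -> 0 < delta -> t + delta <= s ->
  (\sum_(1 <= i <oo) (a i * expR (- (rho i * s)))%:E
    <= (expR (- (rho 1%N * delta)) * (1 + t / delta))%:E)%E.
Proof.
move=> a0 rho1 rho_ge locE t0 d0 tds.
apply: lime_le.
  by apply: is_cvg_nneseries => i i1 _; rewrite lee_fin mulr_ge0 ?a0// expR_ge0.
apply: nearW => N; rewrite sumEFin lee_fin big_add1.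
set G := potential (rho 1%N) t delta.
pose S i := \sum_(1 <= j < i.+1) a j.
have S_ge0 i : 0 <= S i.
  by rewrite /S big_nat; apply: sumr_ge0 => j /andP[j1 _]; exact: a0.
have SS i : S i.+1 - S i = a i.+1.
  by rewrite /S big_nat_recr//= -addrA addrC subrK.
apply: (@le_trans _ _ (G (S N.-1) - G (S 0%N))).
  rewrite -(telescope_sumr (fun i => G (S i)))//.
  rewrite !big_mkord; apply: ler_sum => -[i _] _ /=.
  apply: (@le_trans _ _ (a i.+1 * expR (- (rho i.+1 * (t + delta))))).
    rewrite ler_wpM2l ?a0// ler_expR lerN2 ler_wpM2l//.
    by rewrite (le_trans (ltW rho1)) ?rho_ge.
  rewrite -SS; apply: potential_increment => //; first exact: rho_ge.
    by rewrite S_ge0 -subr_ge0 SS a0.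
  have rhoi0 : 0 < rho i.+1 by rewrite (lt_le_trans rho1) ?rho_ge.
  apply: le_trans (ln_cumul_le locE _ rhoi0) => //.
  have [S0|S0] := leP (S i.+1) 0.
    by rewrite ln0// ln_ge0// le_max lexx.
  rewrite ler_ln ?posrE ?lt_max ?ltr01//.
  by rewrite le_max lexx orbT.
have -> : S 0%N = 0 by rewrite /S big_geq.
rewrite /G /potential.
set B := expR (rho 1%N * t); have B0 : 0 < B by rewrite expR_gt0.
rewrite [Num.min 0 _]min_l ?(ltW B0)// [Num.max 0 _]max_r ?(ltW B0)//.
have -> : expR (- (delta / t * ln B)) = expR (- (rho 1%N * delta)).
  by rewrite expRK; congr expR; field; rewrite gt_eqF.
have -> : expR (- (rho 1%N * delta)) = B * expR (- (rho 1%N * (t + delta))).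
  by rewrite -expRD; congr expR; ring.
set E := expR (- (rho 1%N * (t + delta))).
set F := expR _.
have F0 : 0 <= t / delta * F by rewrite mulr_ge0 ?expR_ge0// divr_ge0// ltW.
have : Num.min (S N.-1) B * E <= B * E.
  by rewrite ler_wpM2r ?expR_ge0// ge_min lexx orbT.
lra.
Qed.

(** The supremum defining the location need not be attained, hence the loss
    [eta] in the exponent, which is then made arbitrarily small. *)
Lemma expsum_ge a rho t b s :
  (forall i, (1 <= i)%N -> 0 <= a i) ->
  (forall i, (1 <= i)%N -> 0 < rho i) ->
  (forall i j, (1 <= i <= j)%N -> rho i <= rho j) ->
  location_ereal a rho = t%:E -> 0 < b -> 0 <= s <= t - b / rho 1%N ->
  ((expR b)%:E <= \sum_(1 <= i <oo) (a i * expR (- (rho i * s)))%:E)%E.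
Proof.
move=> a0 rho0 rho_nd locE b0 /andP[s0 st].
have rho1 := rho0 1%N isT.
have a_ge0 i : (1 <= i)%N -> true ->
    (0 <= (a i * expR (- (rho i * s)))%:E)%E.
  by move=> i1 _; rewrite lee_fin mulr_ge0 ?a0// expR_ge0.
apply/lee_addgt0Pr => e e0.
(* [exp(b - eta) >= exp b * (1 - eta)], so this choice loses at most [e]. *)
pose eta := Num.min b (e / expR b).
have eta0 : 0 < eta by rewrite lt_min b0 divr_gt0// expR_gt0.
have etab : eta <= b by rewrite ge_min lexx.
have etae : expR b <= expR (b - eta) + e.
  have : expR b * eta <= e.
    by rewrite mulrC -ler_pdivlMr ?expR_gt0// ge_min lexx orbT.
  have : expR b * (1 + - eta) <= expR (b - eta).
    by rewrite expRD ler_pM2l ?expR_gt0//; exact: expR_ge1Dx.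
  lra.
(* [expR (b - eta)] is reached by the terms up to a nearly maximal index. *)
have [_ [i /= i1 <-]] : exists2 y,
    [set (ln (cumul a i) / rho i)%:E | i in [set i | (1 <= i)%N]] y
    & ((t - eta / rho 1%N)%:E < y)%E.
  apply: ereal_sup_gt; rewrite -/(location_ereal a rho) locE lte_fin.
  by rewrite ltrBlDr ltrDl divr_gt0.
rewrite lte_fin => ti; have rhoi := rho0 i i1.
(* The near-supremum is positive, so [cumul a i] is the sum and not [1]. *)
have cumul_gt1 : 1 < cumul a i.
  rewrite ltNge; apply/negP => /ln_le0 lnle0.
  have /le_lt_trans/(_ ti) : 0 <= t - eta / rho 1%N.
    rewrite (le_trans s0)// (le_trans st)// lerB// ler_pM2r//.
    by rewrite invr_gt0.
  by rewrite ltNge pmulr_lle0 ?invr_gt0// lnle0.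
have cumulE : cumul a i = \sum_(1 <= j < i.+1) a j.
  by move: cumul_gt1; rewrite /cumul lt_max ltxx /= => /ltW/max_r.
apply: (@le_trans _ _ ((expR (b - eta))%:E + e%:E)%E).
  by rewrite -EFinD lee_fin.
rewrite leeD2r//.
apply: le_trans (nneseries_lim_ge i.+1 a_ge0).
rewrite sumEFin lee_fin.
apply: (@le_trans _ _ (cumul a i * expR (- (rho i * s)))).
  rewrite -[X in X * _]lnK ?posrE ?(lt_trans _ cumul_gt1)// -expRD ler_expR.
  have rho1i : rho 1%N <= rho i by rewrite rho_nd// i1.
  have h1 : b - eta <= rho i * ((b - eta) / rho 1%N).
    rewrite mulrCA ler_peMr ?subr_ge0//.
    by rewrite ler_pdivlMr// mul1r.
  have h2 : rho i * ((b - eta) / rho 1%N) <= rho i * (ln (cumul a i) / rho i - s).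
    by rewrite ler_pM2l//; move: ti st; rewrite !mulrBl; lra.
  apply: le_trans h1 (le_trans h2 _).
  by rewrite mulrBr mulrCA divff ?gt_eqF// mulr1.
rewrite cumulE mulr_suml !big_nat; apply: ler_sum => j /andP[j1 ji].
rewrite ler_wpM2l ?a0// ler_expR lerN2 ler_wpM2r//.
by rewrite rho_nd// j1.
Qed.

End ExponentialSum.

(** * The limiting profile *)

Section Profile.
Context {R : realType}.

Lemma ln_cvgy : @ln R x @[x --> +oo] --> +oo.
Proof.
apply/cvgryPge => A; near=> x.
have x0 : 0 < x by near: x; exact: nbhs_pinfty_gt.
rewrite -ler_expR lnK//; near: x; exact: nbhs_pinfty_ge.
Unshelve. all: by end_near. Qed.

Lemma cvg_mulr_expRN : x * expR (- x) @[x --> +oo] --> (0 : R).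
Proof.
have inv_cvg0 : 2 / x @[x --> +oo] --> (0 : R).
  rewrite -[X in _ --> X](mulr0 2); apply: cvgMr.
  by apply/gtr0_cvgV0; [exact: nbhs_pinfty_gt | exact: cvg_id].
apply: (squeeze_cvgr _ (cvg_cst 0) inv_cvg0).
near=> x; have x0 : 0 < x by near: x; exact: nbhs_pinfty_gt.
rewrite mulr_ge0 ?expR_ge0 ?(ltW x0)//= expRN ler_pdivrMr ?expR_gt0//.
rewrite mulrAC ler_pdivlMr//.
have : 1 + x ^+ 2 / 2 <= expR x by exact: (expR_ge1Dxn 1 (ltW x0)).
rewrite expr2; lra.
Unshelve. all: by end_near. Qed.

(** Substitute [x := ln x] in [cvg_mulr_expRN]. *)
Lemma cvg_ln_div : @ln R x / x @[x --> +oo] --> (0 : R).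
Proof.
have := cvg_comp _ _ ln_cvgy cvg_mulr_expRN.
apply: cvg_trans; apply: near_eq_cvg; near=> x => /=.
have x0 : 0 < x by near: x; exact: nbhs_pinfty_gt.
by rewrite expRN lnK.
Unshelve. all: by end_near. Qed.

(** The bound of [expsum_le] at [delta = r + c * w], written in terms of
    [v = ln (rho 1 * t)]. *)
Definition right_profile (c v : R) : R :=
  expR (- (v - ln v + c)) * (1 + expR v / (v - ln v + c)).

(** The factor [exp(- (v - ln v))] is [v * exp(- v)]: it kills the [1] and turns
    the quotient into [v / (v - ln v + c)], which tends to [1] as [ln v = o(v)]. *)
Lemma cvg_right_profile (c : R) : 0 < c ->
  right_profile c v @[v --> +oo] --> expR (- c).
Proof.
move=> c0; have cV : c / v @[v --> +oo] --> (0 : R).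
  rewrite -[X in _ --> X](mulr0 c); apply: cvgMr.
  by apply/gtr0_cvgV0; [exact: nbhs_pinfty_gt | exact: cvg_id].
have main : expR (- c) * (v * expR (- v) + (1 - ln v / v + c / v)^-1) @[v --> +oo]
    --> expR (- c).
  rewrite -[X in _ --> X]mulr1; apply: cvgMr.
  rewrite -[X in _ --> X]add0r; apply: cvgD; first exact: cvg_mulr_expRN.
  rewrite -[X in _ --> X]invr1; apply: cvgV; first exact: oner_neq0.
  rewrite -[X in _ --> X]addr0; apply: cvgD => //.
  rewrite -[X in _ --> X]subr0; apply: cvgB; first exact: cvg_cst.
  exact: cvg_ln_div.
apply: cvg_trans main; apply: near_eq_cvg; near=> v; rewrite /right_profile /=.
have v0 : 0 < v by near: v; exact: nbhs_pinfty_gt.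
have lnv : ln v <= v - 1.
  have -> : v = 1 + (v - 1) by ring.
  by rewrite [leRHS]addrAC subrr add0r; apply: le_ln1Dx; lra.
have vc : 0 < v - ln v + c by lra.
have -> : expR (- (v - ln v + c)) = expR (- c) * v * expR (- v).
  by rewrite -[X in _ * X * _](lnK v0) -!expRD; congr expR; ring.
have -> : expR (- c) * (v * expR (- v) + (1 - ln v / v + c / v)^-1) =
   expR (- c) * (v * expR (- v) + (v / (v - ln v + c))).
  congr (_ * (_ + _)); rewrite -[RHS]invf_div; congr (_^-1).
  by field; rewrite gt_eqF.
by rewrite (expRN v); field; rewrite !gt_eqF ?expR_gt0.
Unshelve. all: by end_near. Qed.

End Profile.

(** * Limits superior and inferior under eventual bounds *)

Section EventualBounds.
Context {R : realType}.

Lemma limn_esup_le_near (u : (\bar R)^nat) (l : \bar R) :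
  (\forall n \near \oo, (u n <= l)%E) -> (limn_esup u <= l)%E.
Proof.
move=> ul; apply: (@le_trans _ _ (ereal_sup (u @` [set n | (u n <= l)%E]))).
  by apply: ereal_inf_lbound; exists [set n | (u n <= l)%E].
by apply: ge_ereal_sup => _ [n /= unl <-].
Qed.

Lemma limn_einf_ge_near (u : (\bar R)^nat) (l : \bar R) :
  (\forall n \near \oo, (l <= u n)%E) -> (l <= limn_einf u)%E.
Proof.
move=> lu; rewrite /limn_einf leeNr; apply: limn_esup_le_near.
by apply: filterS lu => n; rewrite leeN2.
Qed.

Lemma limn_esup_le_cvg_near (u : (\bar R)^nat) (f : nat -> R) (l : R) :
  (\forall n \near \oo, (u n <= (f n)%:E)%E) -> f n @[n --> \oo] --> l ->
  (limn_esup u <= l%:E)%E.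
Proof.
move=> uf fl; apply/lee_addgt0Pr => e e0; apply: limn_esup_le_near.
have /cvgr_lt/(_ (l + e)) fle := fl.
have := fle; rewrite ltrDl => /(_ e0); apply: filterS2 uf => n unf fnl.
by rewrite (le_trans unf)// -EFinD lee_fin ltW.
Qed.

End EventualBounds.

(** * The cutoff *)

Theorem theorem2p1 (R : realType)
  (* the processes X_n, on probability spaces (Omega_n, Pr_n), with values in S_n *)
  (disp : nat -> measure_display)
  (Omega : forall n, measurableType (disp n))
  (Pr : forall n, probability (Omega n) R)
  (S : nat -> ptopologicalType)
  (X : forall n, R -> {RV (Pr n) >-> borel (S n)})
  (nu : forall n, probability (borel (S n)) R)
  (D : forall n,
     probability (borel (S n)) R -> probability (borel (S n)) R -> \bar R)
  (a rho : nat -> nat -> R) :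
  let law n (s : R) : probability (borel (S n)) R := distribution (Pr n) (X n s) in
  let d n (s : R) : \bar R := D n (law n s) (nu n) in
  let t n := location (a n) (rho n) in
  let w n := width (rho n) in
  let r n := shift (a n) (rho n) in
  (forall n, (1 <= n)%N -> cvg_in_distribution (law n) (nu n)) ->
  (forall n, (1 <= n)%N -> prob_distance +oo%E (D n)) ->
  (forall n i, (1 <= n)%N -> (1 <= i)%N -> 0 < rho n i) ->
  (forall n i j, (1 <= n)%N -> (1 <= i <= j)%N -> rho n i <= rho n j) ->
  (forall n i, (1 <= n)%N -> (1 <= i)%N -> 0 <= a n i) ->
  (forall n, (1 <= n)%N -> 0 < a n 1%N) ->
  (forall n (s : R), (1 <= n)%N -> 0 <= s ->
     d n s = (\sum_(1 <= i <oo) (a n i * expR (- (rho n i * s)))%:E)%E) ->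
  (\forall n \near \oo, (0 < location_ereal (a n) (rho n) < +oo)%E) ->
  rho n 1%N * t n @[n --> \oo] --> +oo ->
  (exists2 alpha : R, 0 < alpha &
     \forall n \near \oo, forall i, (2 <= i)%N ->
       a n i <= alpha * cumul (a n) i.-1) ->
  [/\ left_window_cutoff +oo%E d t w,
      right_window_cutoff d (fun n => t n + r n) w,
      forall c : R, c < 0 ->
        ((expR (- c))%:E <= limn_einf (fun n => d n (t n + c * w n)%R))%E
    & forall c : R, 0 < c ->
        (limn_esup (fun n => d n (t n + r n + c * w n)%R) <= (expR (- c))%:E)%E].
Proof.
move=> law d t w r _ distD rho0 rho_nd a0 _ dE loc_fin u_cvg _.
have rho1 n : (1 <= n)%N -> 0 < rho n 1%N by move=> n1; exact: rho0.
pose u n := rho n 1%N * t n.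
pose v n := ln (u n).
have v_cvg : v n @[n --> \oo] --> +oo by exact: cvg_comp u_cvg ln_cvgy.
have good : \forall n \near \oo, [/\ (1 <= n)%N,
    location_ereal (a n) (rho n) = (t n)%:E, 0 < t n & 1 < v n].
  near=> n; have n1 : (1 <= n)%N by near: n; exact: nbhs_infty_ge.
  have /andP[L0 Ly] : (0 < location_ereal (a n) (rho n) < +oo)%E.
    by near: n; exact: loc_fin.
  have LE : location_ereal (a n) (rho n) = (t n)%:E.
    by rewrite /t /location fineK// gt0_fin_numE.
  split => //; first by rewrite -lte_fin -LE.
  by near: n; move/cvgryPgt : v_cvg; exact.
have w_gt0 n : (1 <= n)%N -> 0 < w n.
  by move=> n1; rewrite /w /width invr_gt0 rho1.
have wt_cvg : w n / t n @[n --> \oo] --> 0.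
  have : (u n)^-1 @[n --> \oo] --> (0 : R).
    apply/gtr0_cvgV0 => //.
    by move/cvgryPgt : u_cvg; exact.
  apply: cvg_trans; apply: near_eq_cvg; apply: nearW => n.
  by rewrite /u /w /width invfM.
have left_bound n c s : [/\ (1 <= n)%N,
      location_ereal (a n) (rho n) = (t n)%:E, 0 < t n & 1 < v n] ->
    c < 0 -> 0 <= s <= t n + c * w n -> ((expR (- c))%:E <= d n s)%E.
  move=> [n1 locE _ _] c0 /andP[s0 sle]; rewrite dE//.
  apply: (@expsum_ge _ _ _ (t n)) => //.
  - by move=> i; exact: a0.
  - by move=> i; exact: rho0.
  - by move=> i j; exact: rho_nd.
  - by rewrite oppr_gt0.
  - by rewrite s0 mulNr opprK.
pose delta n c := r n + c * w n.
have deltaE n c : (1 <= n)%N -> rho n 1%N * delta n c = v n - ln (v n) + c.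
  move=> n1; rewrite /delta /r /shift -/(t n) -/(u n) -/(v n) /w /width.
  by field; rewrite gt_eqF ?rho1.
(* This makes the shift positive, and [delta n c] too when [c > 0]. *)
have lnv n : 1 < v n -> 1 <= v n - ln (v n).
  move=> v1; have : ln (1 + (v n - 1)) <= v n - 1 by apply: le_ln1Dx; lra.
  by rewrite [1 + _]addrC subrK; lra.
have profile_cvg c : 0 < c -> right_profile c (v n) @[n --> \oo] --> expR (- c).
  by move=> c0; exact: cvg_comp v_cvg (cvg_right_profile c0).
have right_bound n c s : [/\ (1 <= n)%N,
      location_ereal (a n) (rho n) = (t n)%:E, 0 < t n & 1 < v n] ->
    0 < c -> t n + r n + c * w n <= s -> (d n s <= (right_profile c (v n))%:E)%E.
  move=> [n1 locE t0 v1] c0 sge.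
  have q0 : 0 < v n - ln (v n) + c by have := lnv n v1; lra.
  have d0 : 0 < delta n c by rewrite -(pmulr_rgt0 _ (rho1 n n1)) deltaE.
  have sge' : t n + delta n c <= s by rewrite /delta addrA.
  rewrite dE//; last by rewrite (le_trans _ sge')// ltW// addr_gt0.
  have rho1_le i : (1 <= i)%N -> rho n 1%N <= rho n i.
    by move=> i1; apply: rho_nd; rewrite ?i1.
  apply: (le_trans (expsum_le (a0 n ^~ n1) (rho1 n n1) rho1_le locE t0 d0 sge')).
  rewrite lee_fin /right_profile deltaE// lnK; last first.
    by rewrite posrE mulr_gt0 ?rho1.
  rewrite -(deltaE n c n1) /u invfM mulrACA divff ?mul1r// gt_eqF ?rho1//.
have r_gt0 n : (1 <= n)%N -> 1 < v n -> 0 < r n.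
  move=> n1 v1; rewrite -(pmulr_rgt0 _ (rho1 n n1)).
  have := deltaE n 0 n1; rewrite /delta mul0r !addr0 => ->.
  by have := lnv n v1; lra.
split.
- split.
    split => //; first by apply: filterS good => n [_ _ t0 _].
    by apply: filterS good => n [n1 _ _ _]; exact: w_gt0.
  apply/cvgeyPge => A; near=> c.
  have c0 : c < 0 by near: c; exact: nbhs_ninfty_lt.
  have Ac : A <= expR (- c).
    apply: le_trans (expR_ge1Dx (- c)).
    have : c <= - A by near: c; exact/nbhs_ninfty_le/num_real.
    lra.
  apply: limn_einf_ge_near; apply: filterS good => n gn.
  apply: le_ereal_inf_tmp => _ [s /= /andP[s0 slt] <-].
  apply: (@le_trans _ _ (expR (- c))%:E); first by rewrite lee_fin.
  by apply: left_bound gn c0 _; rewrite s0 ltW.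
- split.
    split.
    + by apply: filterS good => n [n1 _ t0 v1]; rewrite addr_gt0 ?r_gt0.
    + by apply: filterS good => n [n1 _ _ _]; exact: w_gt0.
    + apply: (squeeze_cvgr _ (cvg_cst 0) wt_cvg).
      apply: filterS good => n [n1 _ t0 v1].
      have r0 := r_gt0 n n1 v1.
      have tr0 : 0 < t n + r n by rewrite addr_gt0.
      rewrite divr_ge0 ?(ltW (w_gt0 n n1)) ?(ltW tr0)//=.
      by rewrite ler_pM2l ?w_gt0// lef_pV2 ?posrE ?addr_gt0// lerDl ltW.
  have exp_cvg0 : (expR (- c))%:E @[c --> +oo] --> (0%E : \bar R).
    by apply: cvg_EFin; [exact: nearW | exact: cvgr_expR].
  apply: (squeeze_cvge _ (cvg_cst 0%E) exp_cvg0); near=> c.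
  have c0 : 0 < c by near: c; exact: nbhs_pinfty_gt.
  apply/andP; split.
    apply: le_trans (limn_einf_sup _); apply: limn_einf_ge_near.
    apply: filterS good => n [n1 _ t0 v1].
    (* The window of times is nonempty and the distance is nonnegative, so
       the supremum is. *)
    pose s := t n + r n + c * w n + 1.
    have s_gt : t n + r n + c * w n < s by rewrite ltrDl.
    apply: le_trans (ereal_sup_ubound _); last first.
      exists s => //=; split=> //; apply: ltW (lt_trans _ s_gt).
      by rewrite !addr_gt0 ?r_gt0 ?mulr_gt0 ?w_gt0.
    exact: prob_distance_ge0 (distD n n1) _ _.
  apply: limn_esup_le_cvg_near (profile_cvg c c0).
  apply: filterS good => n gn; apply: ge_ereal_sup => _ [s /= [s0 slt] <-].
  exact: right_bound gn c0 (ltW slt).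
- move=> c c0; apply: limn_einf_ge_near; near=> n.
  have gn : [/\ (1 <= n)%N,
    location_ereal (a n) (rho n) = (t n)%:E, 0 < t n & 1 < v n] by near: n.
  have [n1 _ _ _] := gn.
  apply: left_bound gn c0 _; rewrite lexx andbT.
  (* [t n + c * w n] is a nonnegative time as soon as [u n >= - c]. *)
  have : - c <= u n by near: n; move/cvgryPge : u_cvg; exact.
  rewrite /u /w /width -subr_ge0 => uc.
  rewrite -(pmulr_rge0 _ (rho1 n n1)) mulrDr mulrCA divff ?gt_eqF ?rho1//.
  lra.
- move=> c c0; apply: limn_esup_le_cvg_near (profile_cvg c c0).
  by apply: filterS good => n gn; exact: right_bound gn c0 (lexx _).
Unshelve. all: by end_near. Qed.
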